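(* Let $\mathbb{C}$ be a finitely complete and finitely cocomplete category, let $\mathcal{N}=\mathsf{NMono}(\mathbb{C})$ and $\mathcal{P}=\mathsf{NEpi}(\mathbb{C})$ be its classes of normal monomorphisms and normal epimorphisms, and for a morphism $f$ let $\kappa_f$ be its comparison morphism. (1) The following are equivalent: (i) the class $\mathcal{N}$ is closed under composition; (ii) $\mathcal{N}$ belongs to an orthogonal factorization system $(\mathcal{C},\mathcal{N})$ of $\mathbb{C}$, for some class $\mathcal{C}$; (iii) every comparison morphism lies in ${}^{\bot}\mathcal{N}$. (2) The following are equivalent: (i) the class $\mathcal{P}$ is closed under composition; (ii) $\mathcal{P}$ belongs to an orthogonal factorization system $(\mathcal{P},\mathcal{F})$ of $\mathbb{C}$, for some class $\mathcal{F}$; (iii) every comparison morphism lies in $\mathcal{P}^{\bot}$. (3) Every comparison morphism lies in ${}^{\bot}\mathcal{N}\cap\mathcal{P}^{\bot}$ if, and only if, the classes $\mathcal{N}$ and $\mathcal{P}$ are both closed under composition; equivalently, if for all morphisms $f$ of $\mathbb{C}$, $$\kappa_f\in\mathcal{K}:=\{k\in\mathrm{mor}(\mathbb{C})\mid \nu_k\text{ and }\pi_k\text{ are isomorphisms}\}.$$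
   Context: Let $1$ and $0$ denote the terminal and initial object of $\mathbb{C}$. For a morphism $f:A\to B$ in $\mathbb{C}$, form the pushout $B+_A1$ of $f$ along $A\to 1$, and let $N_f$ be the pullback of the two pushout injections $B\to B+_A1\leftarrow 1$, with projection $\nu_f:N_f\to B$; let $\hat f:A\to N_f$ be the induced morphism with $\nu_f\cdot\hat f=f$. Dually, form the pullback $0\times_BA$ of $0\to B$ and $f$, and let $P_f$ be the pushout of the two projections $0\leftarrow 0\times_BA\to A$, with injection $\pi_f:A\to P_f$; let $\check f:P_f\to B$ be the induced morphism with $\check f\cdot\pi_f=f$. The morphism $f$ is a normal monomorphism if $\hat f$ is an isomorphism, and a normal epimorphism if $\check f$ is an isomorphism. The morphism $\nu_f$ is always a regular monomorphism and $\pi_f$ is always a regular epimorphism. The comparison morphism of $f$ is the unique morphism $\kappa_f:P_f\to N_f$ with $\kappa_f\cdot\pi_f=\hat f$ and $\nu_f\cdot\kappa_f=\check f$; thus $f=\nu_f\cdot\kappa_f\cdot\pi_f$ (the normal decomposition of $f$). For morphisms $f,g$, one writes $f\bot g$ if whenever $g\cdot u=v\cdot f$ there is a unique $t$ with $t\cdot f=u$ and $g\cdot t=v$. For classes of morphisms, ${}^{\bot}\mathcal{M}=\{f\mid \forall m\in\mathcal{M}: f\bot m\}$ and $\mathcal{E}^{\bot}=\{g\mid\forall e\in\mathcal{E}: e\bot g\}$. A pair $(\mathcal{E},\mathcal{M})$ of classes of morphisms, each containing all identities and closed under composition with isomorphisms from either side, is an orthogonal factorization system of $\mathbb{C}$ if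 every morphism of $\mathbb{C}$ is of the form $m\cdot e$ with $e\in\mathcal{E}$, $m\in\mathcal{M}$, and if $e\bot m$ for all $e\in\mathcal{E}$, $m\in\mathcal{M}$. (When the equivalent conditions of (3) hold, the normal decompositions in $\mathbb{C}$ are called perfect.) *)

(* Defs.v *)
From Stdlib Require Import List FinFun.
Import ListNotations.

Set Implicit Arguments.
Unset Strict Implicit.
Unset Printing Implicit Defensive.

Declare Scope category_scope.
Delimit Scope category_scope with cat.
Local Open Scope category_scope.

(** ** Categories and functors *)

Record category : Type := Category {
  ob :> Type;
  hom : ob -> ob -> Type;
  idm : forall A, hom A A;
  comp : forall A B D, hom B D -> hom A B -> hom A D;
  comp_idl : forall A B (f : hom A B), comp (idm B) f = f;
  comp_idr : forall A B (f : hom A B), comp f (idm A) = f;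
  comp_assoc : forall A B D E (h : hom D E) (g : hom B D) (f : hom A B),
    comp h (comp g f) = comp (comp h g) f
}.

Arguments hom {c} _ _.
Arguments idm {c} _.
Arguments comp {c A B D} _ _.

Notation "g ∘ f" := (comp g f) (at level 40, left associativity) : category_scope.

Record functor (J C : category) : Type := Functor {
  fob :> J -> C;
  fmap : forall i j : J, hom i j -> hom (fob i) (fob j);
  fmap_id : forall i, fmap (idm i) = idm (fob i);
  fmap_comp : forall i j k (b : hom j k) (a : hom i j),
    fmap (b ∘ a) = fmap b ∘ fmap a
}.

Definition is_iso (C : category) (A B : C) (f : hom A B) : Prop :=
  exists g : hom B A, g ∘ f = idm A /\ f ∘ g = idm B.

(** ** Finite limits and colimits *)

Definition finite_category (J : category) : Prop :=
  Finite J /\ forall i j : J, Finite (hom i j).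

Record cone (J C : category) (D : functor J C) : Type := Cone {
  cone_apex : C;
  cone_leg : forall i, hom cone_apex (D i);
  cone_nat : forall i j (a : hom i j), fmap D a ∘ cone_leg i = cone_leg j
}.

Record limit (J C : category) (D : functor J C) : Type := Limit {
  lim_cone :> cone D;
  lim_med : forall c : cone D, hom (cone_apex c) (cone_apex lim_cone);
  lim_fac : forall (c : cone D) i, cone_leg lim_cone i ∘ lim_med c = cone_leg c i;
  lim_uniq : forall (c : cone D) (t : hom (cone_apex c) (cone_apex lim_cone)),
    (forall i, cone_leg lim_cone i ∘ t = cone_leg c i) -> t = lim_med c
}.

Record cocone (J C : category) (D : functor J C) : Type := Cocone {
  cocone_apex : C;
  cocone_leg : forall i, hom (D i) cocone_apex;
  cocone_nat : forall i j (a : hom i j), cocone_leg j ∘ fmap D a = cocone_leg i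
}.

Record colimit (J C : category) (D : functor J C) : Type := Colimit {
  colim_cocone :> cocone D;
  colim_med : forall c : cocone D, hom (cocone_apex colim_cocone) (cocone_apex c);
  colim_fac : forall (c : cocone D) i,
    colim_med c ∘ cocone_leg colim_cocone i = cocone_leg c i;
  colim_uniq : forall (c : cocone D) (t : hom (cocone_apex colim_cocone) (cocone_apex c)),
    (forall i, t ∘ cocone_leg colim_cocone i = cocone_leg c i) -> t = colim_med c
}.

(** Finite (co)completeness is carried as a choice of (co)limits, so that
    [N_f], [nu_f], [kappa_f], etc. are functions of [f].  A theorem that
    quantifies over [finitely_complete C] holds for every such choice. *)

Definition finitely_complete (C : category) : Type :=
  forall J : category, finite_category J -> forall D : functor J C, limit D.

Definition finitely_cocomplete (C : category) : Type :=
  forall J : category, finite_category J -> forall D : functor J C, colimit D.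

(** ** Diagram shapes *)

Definition empty_category : category.
Proof.
  refine (@Category Empty_set (fun _ _ => Empty_set)
               (fun A => A) (fun A _ _ _ _ => A) _ _ _); intros [].
Defined.

Lemma empty_category_finite : finite_category empty_category.
Proof. split; [exists nil; intros [] | intros []]. Qed.

Definition empty_diagram (C : category) : functor empty_category C.
Proof.
  refine (@Functor empty_category C
               (fun i : Empty_set => match i with end)
               (fun i : Empty_set => match i with end) _ _); intros [].
Defined.

Inductive corner : Set := corner1 | corner2 | middle.

(** The shape [corner1 -> middle <- corner2]. *)
Definition cospan_hom (i j : corner) : Set :=
  match i, j with
  | corner1, corner1 | corner2, corner2 | middle, middle
  | corner1, middle | corner2, middle => unit
  | _, _ => Empty_set
  end.

Lemma cospan_hom_eq i j (a b : cospan_hom i j) : a = b.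
Proof. destruct i, j; destruct a; destruct b; reflexivity. Qed.

Definition cospan_id i : cospan_hom i i :=
  match i with corner1 | corner2 | middle => tt end.

Definition cospan_comp i j k : cospan_hom j k -> cospan_hom i j -> cospan_hom i k.
Proof. destruct i, j, k; intros b a; first [exact tt | solve [destruct a] | solve [destruct b]]. Defined.

Definition cospan : category.
Proof.
  refine (@Category corner cospan_hom cospan_id cospan_comp _ _ _);
     intros; apply cospan_hom_eq.
Defined.

(** The shape [corner1 <- middle -> corner2]. *)
Definition span : category.
Proof.
  refine (@Category corner (fun i j => cospan_hom j i) cospan_id
               (fun i j k b a => cospan_comp a b) _ _ _);
     intros; apply cospan_hom_eq.
Defined.

Lemma corner_finite : Finite corner.
Proof. exists [corner1; corner2; middle]; intros []; simpl; auto. Qed.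

Lemma cospan_hom_finite i j : Finite (cospan_hom i j).
Proof.
  destruct i, j; (exists nil; intros []; fail) || (exists [tt]; intros []; simpl; auto).
Qed.

Lemma cospan_finite : finite_category cospan.
Proof. split; [exact corner_finite | exact cospan_hom_finite]. Qed.

Lemma span_finite : finite_category span.
Proof. split; [exact corner_finite | intros i j; exact (cospan_hom_finite j i)]. Qed.

Definition corner_case (T : Type) (x1 x2 x0 : T) (i : corner) : T :=
  match i with corner1 => x1 | corner2 => x2 | middle => x0 end.

Definition cospan_map (C : category) (A1 A2 S : C) (f : hom A1 S) (g : hom A2 S)
    (i j : corner) :
    cospan_hom i j -> hom (corner_case A1 A2 S i) (corner_case A1 A2 S j) :=
  match i, j return
    cospan_hom i j -> hom (corner_case A1 A2 S i) (corner_case A1 A2 S j) with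
  | corner1, corner1 => fun _ => idm A1
  | corner2, corner2 => fun _ => idm A2
  | middle, middle => fun _ => idm S
  | corner1, middle => fun _ => f
  | corner2, middle => fun _ => g
  | _, _ => fun a : Empty_set => match a with end
  end.

Definition cospan_diagram (C : category) (A1 A2 S : C) (f : hom A1 S) (g : hom A2 S) :
  functor cospan C.
Proof.
  refine (@Functor cospan C (corner_case A1 A2 S) (cospan_map f g) _ _).
  - intros []; reflexivity.
  - intros [] [] [] b a; destruct a; destruct b; simpl;
      rewrite ?comp_idl, ?comp_idr; reflexivity.
Defined.

Definition span_map (C : category) (B1 B2 S : C) (f : hom S B1) (g : hom S B2)
    (i j : corner) :
    cospan_hom j i -> hom (corner_case B1 B2 S i) (corner_case B1 B2 S j) :=
  match i, j return
    cospan_hom j i -> hom (corner_case B1 B2 S i) (corner_case B1 B2 S j) with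
  | corner1, corner1 => fun _ => idm B1
  | corner2, corner2 => fun _ => idm B2
  | middle, middle => fun _ => idm S
  | middle, corner1 => fun _ => f
  | middle, corner2 => fun _ => g
  | _, _ => fun a : Empty_set => match a with end
  end.

Definition span_diagram (C : category) (B1 B2 S : C) (f : hom S B1) (g : hom S B2) :
  functor span C.
Proof.
  refine (@Functor span C (corner_case B1 B2 S) (span_map f g) _ _).
  - intros []; reflexivity.
  - intros [] [] [] b a; destruct a; destruct b; simpl;
      rewrite ?comp_idl, ?comp_idr; reflexivity.
Defined.

(** ** Terminal object and pullbacks *)

Section FiniteLimits.
Context {C : category} (L : finitely_complete C).

Definition terminal_limit := L empty_category_finite (empty_diagram C).

Definition terminal : C := cone_apex terminal_limit.

Definition empty_cone (A : C) : cone (empty_diagram C) :=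
  @Cone _ _ (empty_diagram C) A
    (fun i : Empty_set => match i with end)
    (fun i : Empty_set => match i with end).

Definition to_terminal (A : C) : hom A terminal :=
  lim_med terminal_limit (empty_cone A).

Lemma terminal_eq (A : C) (s t : hom A terminal) : s = t.
Proof.
  transitivity (to_terminal A); [|symmetry];
    apply (@lim_uniq _ _ _ terminal_limit (empty_cone A)); intros [].
Qed.

Section Pullback.
Context {A1 A2 S : C} (f : hom A1 S) (g : hom A2 S).

Definition pullback_limit := L cospan_finite (cospan_diagram f g).

Definition pullback : C := cone_apex pullback_limit.
Definition pullback_fst : hom pullback A1 := cone_leg pullback_limit corner1.
Definition pullback_snd : hom pullback A2 := cone_leg pullback_limit corner2.

Lemma pullback_comm : f ∘ pullback_fst = g ∘ pullback_snd.
Proof.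
  transitivity (cone_leg pullback_limit middle).
  - exact (cone_nat pullback_limit (i := corner1) (j := middle) tt).
  - symmetry; exact (cone_nat pullback_limit (i := corner2) (j := middle) tt).
Qed.

Definition cospan_cone (X : C) (u : hom X A1) (v : hom X A2) (e : f ∘ u = g ∘ v) :
  cone (cospan_diagram f g).
Proof.
  refine (@Cone _ _ (cospan_diagram f g) X
    (fun i => match i return hom X (corner_case A1 A2 S i) with
              | corner1 => u | corner2 => v | middle => f ∘ u end) _).
  intros [] [] a; destruct a; simpl; rewrite ?comp_idl; auto.
Defined.

Definition pullback_pair (X : C) (u : hom X A1) (v : hom X A2) (e : f ∘ u = g ∘ v) :
  hom X pullback := lim_med pullback_limit (cospan_cone e).

Lemma pullback_pair_fst (X : C) (u : hom X A1) (v : hom X A2) (e : f ∘ u = g ∘ v) :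
  pullback_fst ∘ pullback_pair e = u.
Proof. exact (lim_fac pullback_limit (cospan_cone e) corner1). Qed.

Lemma pullback_pair_snd (X : C) (u : hom X A1) (v : hom X A2) (e : f ∘ u = g ∘ v) :
  pullback_snd ∘ pullback_pair e = v.
Proof. exact (lim_fac pullback_limit (cospan_cone e) corner2). Qed.

Lemma pullback_eq (X : C) (s t : hom X pullback) :
  pullback_fst ∘ s = pullback_fst ∘ t -> pullback_snd ∘ s = pullback_snd ∘ t -> s = t.
Proof.
  intros e1 e2.
  assert (e : f ∘ (pullback_fst ∘ t) = g ∘ (pullback_snd ∘ t)).
  { rewrite !comp_assoc, pullback_comm; reflexivity. }
  assert (key : forall r : hom X pullback,
    pullback_fst ∘ r = pullback_fst ∘ t -> pullback_snd ∘ r = pullback_snd ∘ t ->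
    r = pullback_pair e).
  { intros r r1 r2; apply (@lim_uniq _ _ _ pullback_limit (cospan_cone e)).
    intros []; simpl; [exact r1 | exact r2 |].
    rewrite <- r1, comp_assoc; f_equal.
    symmetry; exact (cone_nat pullback_limit (i := corner1) (j := middle) tt). }
  rewrite (key s), (key t); auto.
Qed.

End Pullback.
End FiniteLimits.

(** ** Initial object and pushouts *)

Section FiniteColimits.
Context {C : category} (K : finitely_cocomplete C).

Definition initial_colimit := K empty_category_finite (empty_diagram C).

Definition initial : C := cocone_apex initial_colimit.

Definition empty_cocone (A : C) : cocone (empty_diagram C) :=
  @Cocone _ _ (empty_diagram C) A
    (fun i : Empty_set => match i with end)
    (fun i : Empty_set => match i with end).

Definition from_initial (A : C) : hom initial A :=
  colim_med initial_colimit (empty_cocone A).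

Lemma initial_eq (A : C) (s t : hom initial A) : s = t.
Proof.
  transitivity (from_initial A); [|symmetry];
    apply (@colim_uniq _ _ _ initial_colimit (empty_cocone A)); intros [].
Qed.

Section Pushout.
Context {B1 B2 S : C} (f : hom S B1) (g : hom S B2).

Definition pushout_colimit := K span_finite (span_diagram f g).

Definition pushout : C := cocone_apex pushout_colimit.
Definition pushout_inl : hom B1 pushout := cocone_leg pushout_colimit corner1.
Definition pushout_inr : hom B2 pushout := cocone_leg pushout_colimit corner2.

Lemma pushout_comm : pushout_inl ∘ f = pushout_inr ∘ g.
Proof.
  transitivity (cocone_leg pushout_colimit middle).
  - exact (cocone_nat pushout_colimit (i := middle) (j := corner1) tt).
  - symmetry; exact (cocone_nat pushout_colimit (i := middle) (j := corner2) tt).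
Qed.

Definition span_cocone (X : C) (u : hom B1 X) (v : hom B2 X) (e : u ∘ f = v ∘ g) :
  cocone (span_diagram f g).
Proof.
  refine (@Cocone _ _ (span_diagram f g) X
    (fun i => match i return hom (corner_case B1 B2 S i) X with
              | corner1 => u | corner2 => v | middle => u ∘ f end) _).
  intros [] [] a; destruct a; simpl; rewrite ?comp_idr; auto.
Defined.

Definition pushout_copair (X : C) (u : hom B1 X) (v : hom B2 X) (e : u ∘ f = v ∘ g) :
  hom pushout X := colim_med pushout_colimit (span_cocone e).

Lemma pushout_copair_inl (X : C) (u : hom B1 X) (v : hom B2 X) (e : u ∘ f = v ∘ g) :
  pushout_copair e ∘ pushout_inl = u.
Proof. exact (colim_fac pushout_colimit (span_cocone e) corner1). Qed.

Lemma pushout_copair_inr (X : C) (u : hom B1 X) (v : hom B2 X) (e : u ∘ f = v ∘ g) :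
  pushout_copair e ∘ pushout_inr = v.
Proof. exact (colim_fac pushout_colimit (span_cocone e) corner2). Qed.

Lemma pushout_eq (X : C) (s t : hom pushout X) :
  s ∘ pushout_inl = t ∘ pushout_inl -> s ∘ pushout_inr = t ∘ pushout_inr -> s = t.
Proof.
  intros e1 e2.
  assert (e : (t ∘ pushout_inl) ∘ f = (t ∘ pushout_inr) ∘ g).
  { rewrite <- !comp_assoc, pushout_comm; reflexivity. }
  assert (key : forall r : hom pushout X,
    r ∘ pushout_inl = t ∘ pushout_inl -> r ∘ pushout_inr = t ∘ pushout_inr ->
    r = pushout_copair e).
  { intros r r1 r2; apply (@colim_uniq _ _ _ pushout_colimit (span_cocone e)).
    intros []; simpl; [exact r1 | exact r2 |].
    rewrite <- r1, <- comp_assoc; f_equal.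
    symmetry; exact (cocone_nat pushout_colimit (i := middle) (j := corner1) tt). }
  rewrite (key s), (key t); auto.
Qed.

End Pushout.
End FiniteColimits.

(** ** Normal decompositions *)

Section NormalDecomposition.
Context {C : category} (L : finitely_complete C) (K : finitely_cocomplete C).
Context {A B : C} (f : hom A B).

(** [B -> B +_A 1 <- 1] *)
Definition cokernel_in : hom B (pushout K f (to_terminal L A)) :=
  pushout_inl K f (to_terminal L A).
Definition cokernel_pt : hom (terminal L) (pushout K f (to_terminal L A)) :=
  pushout_inr K f (to_terminal L A).

Definition N_ : C := pullback L cokernel_in cokernel_pt.

Definition nu : hom N_ B := pullback_fst L cokernel_in cokernel_pt.

Definition hat : hom A N_ :=
  pullback_pair L (pushout_comm K f (to_terminal L A)).

Lemma nu_hat : nu ∘ hat = f.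
Proof. apply pullback_pair_fst. Qed.

(** [0 <- 0 x_B A -> A] *)
Definition kernel_zero : hom (pullback L (from_initial K B) f) (initial K) :=
  pullback_fst L (from_initial K B) f.
Definition kernel_in : hom (pullback L (from_initial K B) f) A :=
  pullback_snd L (from_initial K B) f.

Definition P_ : C := pushout K kernel_zero kernel_in.

Definition pi : hom A P_ := pushout_inr K kernel_zero kernel_in.

Definition check : hom P_ B :=
  pushout_copair K (pullback_comm L (from_initial K B) f).

Lemma check_pi : check ∘ pi = f.
Proof. apply pushout_copair_inr. Qed.

Lemma nu_mono (X : C) (s t : hom X N_) : nu ∘ s = nu ∘ t -> s = t.
Proof. intros e; apply pullback_eq; [exact e | apply terminal_eq]. Qed.

Lemma pi_epi (X : C) (s t : hom P_ X) : s ∘ pi = t ∘ pi -> s = t.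
Proof. intros e; apply pushout_eq; [apply initial_eq | exact e]. Qed.

Lemma kappa_subproof : from_initial K N_ ∘ kernel_zero = hat ∘ kernel_in.
Proof.
  apply nu_mono; rewrite !comp_assoc, nu_hat.
  rewrite (initial_eq (nu ∘ from_initial K N_) (from_initial K B)).
  apply pullback_comm.
Qed.

Definition kappa : hom P_ N_ := pushout_copair K kappa_subproof.

Lemma kappa_pi : kappa ∘ pi = hat.
Proof. apply pushout_copair_inr. Qed.

Lemma nu_kappa : nu ∘ kappa = check.
Proof. apply pi_epi; rewrite <- comp_assoc, kappa_pi, nu_hat, check_pi; reflexivity. Qed.

Lemma kappa_unique (k : hom P_ N_) : k ∘ pi = hat -> nu ∘ k = check -> k = kappa.
Proof. intros e _; apply pi_epi; rewrite e, kappa_pi; reflexivity. Qed.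

End NormalDecomposition.

(** ** Classes of morphisms *)

Definition mor_class (C : category) : Type := forall A B : C, hom A B -> Prop.

Definition NMono (C : category) (L : finitely_complete C) (K : finitely_cocomplete C) :
  mor_class C := fun A B f => is_iso (hat L K f).

Definition NEpi (C : category) (L : finitely_complete C) (K : finitely_cocomplete C) :
  mor_class C := fun A B f => is_iso (check L K f).

Definition closed_under_comp (C : category) (M : mor_class C) : Prop :=
  forall (A B D : C) (f : hom A B) (g : hom B D), M A B f -> M B D g -> M A D (g ∘ f).

Definition orthogonal (C : category) (A B : C) (f : hom A B) (X Y : C) (g : hom X Y) :
  Prop :=
  forall (u : hom A X) (v : hom B Y), g ∘ u = v ∘ f ->
  exists! t : hom B X, t ∘ f = u /\ g ∘ t = v.

Definition left_orth (C : category) (M : mor_class C) : mor_class C :=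
  fun A B f => forall (X Y : C) (m : hom X Y), M X Y m -> orthogonal f m.

Definition right_orth (C : category) (E : mor_class C) : mor_class C :=
  fun X Y g => forall (A B : C) (e : hom A B), E A B e -> orthogonal e g.

Definition contains_identities (C : category) (M : mor_class C) : Prop :=
  forall A : C, M A A (idm A).

Definition closed_under_iso (C : category) (M : mor_class C) : Prop :=
  (forall (A B D : C) (f : hom A B) (i : hom B D), M A B f -> is_iso i -> M A D (i ∘ f)) /\
  (forall (A B D : C) (i : hom A B) (f : hom B D), is_iso i -> M B D f -> M A D (f ∘ i)).

Record orthogonal_factorization_system (C : category) (E M : mor_class C) : Prop := {
  ofs_id_left : contains_identities E;
  ofs_id_right : contains_identities M;
  ofs_iso_left : closed_under_iso E;
  ofs_iso_right : closed_under_iso M;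
  ofs_factor : forall (A B : C) (f : hom A B),
    exists (X : C) (e : hom A X) (m : hom X B), E A X e /\ M X B m /\ f = m ∘ e;
  ofs_orth : forall (A B X Y : C) (e : hom A B) (m : hom X Y),
    E A B e -> M X Y m -> orthogonal e m
}.

Definition class_meet (C : category) (M M' : mor_class C) : mor_class C :=
  fun A B f => M A B f /\ M' A B f.

Definition KClass (C : category) (L : finitely_complete C) (K : finitely_cocomplete C) :
  mor_class C := fun A B k => is_iso (nu L K k) /\ is_iso (pi L K k).

Definition all_comparisons_in (C : category) (L : finitely_complete C)
    (K : finitely_cocomplete C) (M : mor_class C) : Prop :=
  forall (A B : C) (f : hom A B), M (P_ L K f) (N_ L K f) (kappa L K f).

(* Main.v *)
(** A morphism is a normal monomorphism iff it is a pullback of some point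
    [1 -> Z], so a morphism [f] is left orthogonal to [N] iff it is so to all
    points, i.e. iff [1 -> B +_A 1] is an isomorphism, i.e. iff [nu f] is one.
    In particular every epimorphism, such as [pi f], is left orthogonal to [N];
    hence [hat f = kappa f ∘ pi f] is left orthogonal to [N] as soon as
    [kappa f] is, and then [f = nu f ∘ hat f] is the factorization sought.
    Conversely, [nu f] is the least normal monomorphism through which [f]
    factors, and [f] factors through [nu f ∘ nu (kappa f)]; if this composite is
    normal, [nu (kappa f)] is an isomorphism.  The rest is dual. *)

Require Import Defs.

Set Implicit Arguments.
Unset Strict Implicit.
Unset Printing Implicit Defensive.

Local Open Scope category_scope.

(** * Isomorphisms and orthogonality *)

Section Orthogonality.
Context {C : category}.

Definition mono (A B : C) (f : hom A B) : Prop :=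
  forall (X : C) (s t : hom X A), f ∘ s = f ∘ t -> s = t.

Definition epi (A B : C) (f : hom A B) : Prop :=
  forall (X : C) (s t : hom B X), s ∘ f = t ∘ f -> s = t.

Lemma iso_id (A : C) : is_iso (idm A).
Proof. exists (idm A); split; apply comp_idl. Qed.

Lemma mono_split_epi_iso (A B : C) (f : hom A B) (t : hom B A) :
  mono f -> f ∘ t = idm B -> is_iso f.
Proof.
  intros m e; exists t; split; [|exact e].
  apply m; rewrite comp_assoc, e, comp_idl, comp_idr; reflexivity.
Qed.

Lemma epi_split_mono_iso (A B : C) (f : hom A B) (t : hom B A) :
  epi f -> t ∘ f = idm A -> is_iso f.
Proof.
  intros m e; exists t; split; [exact e|].
  apply m; rewrite <- comp_assoc, e, comp_idl, comp_idr; reflexivity.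
Qed.

Lemma orthogonal_iso_left (A B X Y : C) (f : hom A B) (g : hom X Y) :
  is_iso f -> orthogonal f g.
Proof.
  intros [h [hf fh]] u v e; exists (u ∘ h); repeat split.
  - rewrite <- comp_assoc, hf, comp_idr; reflexivity.
  - rewrite comp_assoc, e, <- comp_assoc, fh, comp_idr; reflexivity.
  - intros t [e1 _]; rewrite <- e1, <- comp_assoc, fh, comp_idr; reflexivity.
Qed.

Lemma orthogonal_iso_right (A B X Y : C) (f : hom A B) (g : hom X Y) :
  is_iso g -> orthogonal f g.
Proof.
  intros [h [hg gh]] u v e; exists (h ∘ v); repeat split.
  - rewrite <- comp_assoc, <- e, comp_assoc, hg, comp_idl; reflexivity.
  - rewrite comp_assoc, gh, comp_idl; reflexivity.
  - intros t [_ e2]; rewrite <- e2, comp_assoc, hg, comp_idl; reflexivity.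
Qed.

Lemma orthogonal_comp_left (A B D X Y : C) (f : hom A B) (f' : hom B D)
    (g : hom X Y) :
  orthogonal f g -> orthogonal f' g -> orthogonal (f' ∘ f) g.
Proof.
  intros o o' u v e; rewrite comp_assoc in e.
  destruct (o _ _ e) as [s [[s1 s2] us]].
  destruct (o' _ _ s2) as [t [[t1 t2] ut]].
  exists t; repeat split.
  - rewrite comp_assoc, t1; exact s1.
  - exact t2.
  - intros t' [e1 e2]; apply ut; split; [|exact e2].
    (* [t' ∘ f'] fills the first square, which has the unique filler [s]. *)
    symmetry; apply us; split.
    + rewrite <- comp_assoc; exact e1.
    + rewrite comp_assoc, e2; reflexivity.
Qed.

Lemma orthogonal_comp_right (A B X Y Z : C) (f : hom A B) (g : hom X Y)
    (g' : hom Y Z) :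
  orthogonal f g -> orthogonal f g' -> orthogonal f (g' ∘ g).
Proof.
  intros o o' u v e; rewrite <- comp_assoc in e.
  destruct (o' _ _ e) as [s [[s1 s2] us]].
  destruct (o _ _ (eq_sym s1)) as [t [[t1 t2] ut]].
  exists t; repeat split.
  - exact t1.
  - rewrite <- comp_assoc, t2; exact s2.
  - intros t' [e1 e2]; apply ut; split; [exact e1|].
    symmetry; apply us; split.
    + rewrite <- comp_assoc, e1; reflexivity.
    + rewrite comp_assoc; exact e2.
Qed.

Lemma left_orth_comp (M : mor_class C) : closed_under_comp (left_orth M).
Proof.
  intros A B D f g Ef Eg X Y m Mm.
  apply orthogonal_comp_left; [apply Ef | apply Eg]; exact Mm.
Qed.

Lemma right_orth_comp (E : mor_class C) : closed_under_comp (right_orth E).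
Proof.
  intros A B D f g Mf Mg X Y e Ee.
  apply orthogonal_comp_right; [apply Mf | apply Mg]; exact Ee.
Qed.

Lemma left_orth_isos (M : mor_class C) (A B : C) (f : hom A B) :
  is_iso f -> left_orth M f.
Proof. intros i X Y m _; apply orthogonal_iso_left, i. Qed.

Lemma right_orth_isos (E : mor_class C) (A B : C) (f : hom A B) :
  is_iso f -> right_orth E f.
Proof. intros i X Y e _; apply orthogonal_iso_right, i. Qed.

Lemma closed_under_iso_of_comp (M : mor_class C) :
  closed_under_comp M -> (forall (A B : C) (f : hom A B), is_iso f -> M A B f) ->
  closed_under_iso M.
Proof. intros c i; split; intros A B D f g Hf Hg; apply c; auto. Qed.

(** Orthogonality holds by the definition of [left_orth], and its closure conditions are automatic;
    only the conditions on [M] and the factorizations have to be supplied. *)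
Lemma left_orth_ofs (M : mor_class C) :
  contains_identities M -> closed_under_iso M ->
  (forall (A B : C) (f : hom A B), exists (X : C) (e : hom A X) (m : hom X B),
    left_orth M e /\ M X B m /\ f = m ∘ e) ->
  orthogonal_factorization_system (left_orth M) M.
Proof.
  intros M1 Mi fac; constructor; auto.
  - intros A; apply left_orth_isos, iso_id.
  - apply closed_under_iso_of_comp; [apply left_orth_comp | apply left_orth_isos].
Qed.

Lemma right_orth_ofs (E : mor_class C) :
  contains_identities E -> closed_under_iso E ->
  (forall (A B : C) (f : hom A B), exists (X : C) (e : hom A X) (m : hom X B),
    E A X e /\ right_orth E m /\ f = m ∘ e) ->
  orthogonal_factorization_system E (right_orth E).
Proof.
  intros E1 Ei fac; constructor; auto.
  - intros A; apply right_orth_isos, iso_id.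
  - apply closed_under_iso_of_comp; [apply right_orth_comp | apply right_orth_isos].
Qed.

(** Filling the square with top [idm A] and bottom [m] yields a retraction [t] of [e]. It is also a
    section because [e ∘ t] and [idm X] both fill the square on [e] and [m]. *)
Lemma orthogonal_factor_iso_left (A B X : C) (e : hom A X) (m : hom X B) :
  orthogonal e m -> orthogonal e (m ∘ e) -> is_iso e.
Proof.
  intros om og.
  destruct (og (idm A) m (comp_idr _)) as [t [[t1 t2] _]].
  exists t; split; [exact t1|].
  destruct (om e m eq_refl) as [s [_ us]].
  rewrite <- (us (e ∘ t)), <- (us (idm X)); [reflexivity | |]; split.
  - apply comp_idl.
  - apply comp_idr.
  - rewrite <- comp_assoc, t1, comp_idr; reflexivity.
  - rewrite comp_assoc; exact t2.
Qed.

Lemma orthogonal_factor_iso_right (A B X : C) (e : hom A X) (m : hom X B) :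
  orthogonal e m -> orthogonal (m ∘ e) m -> is_iso m.
Proof.
  intros oe og.
  destruct (og e (idm B) (eq_sym (comp_idl _))) as [t [[t1 t2] _]].
  exists t; split; [|exact t2].
  destruct (oe e m eq_refl) as [s [_ us]].
  rewrite <- (us (t ∘ m)), <- (us (idm X)); [reflexivity | |]; split.
  - apply comp_idl.
  - apply comp_idr.
  - rewrite <- comp_assoc; exact t1.
  - rewrite comp_assoc, t2, comp_idl; reflexivity.
Qed.

(** Factor the composite as [m ∘ e]. Since [e] is orthogonal to [m] and to both factors of the
    composite, it is an isomorphism, so the composite is [m] up to isomorphism. *)
Lemma ofs_right_comp (E M : mor_class C) :
  orthogonal_factorization_system E M -> closed_under_comp M.
Proof.
  intros F A B D f g Mf Mg.
  destruct (ofs_factor F (g ∘ f)) as (X & e & m & Ee & Mm & fac).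
  rewrite fac; apply (proj2 (ofs_iso_right F)); [|exact Mm].
  apply (@orthogonal_factor_iso_left _ _ _ e m); [apply (ofs_orth F Ee Mm)|].
  rewrite <- fac; apply orthogonal_comp_right; apply (ofs_orth F Ee); assumption.
Qed.

Lemma ofs_left_comp (E M : mor_class C) :
  orthogonal_factorization_system E M -> closed_under_comp E.
Proof.
  intros F A B D f g Ef Eg.
  destruct (ofs_factor F (g ∘ f)) as (X & e & m & Ee & Mm & fac).
  rewrite fac; apply (proj1 (ofs_iso_left F)); [exact Ee|].
  apply (@orthogonal_factor_iso_right _ _ _ e m); [apply (ofs_orth F Ee Mm)|].
  rewrite <- fac; apply orthogonal_comp_left; refine (ofs_orth F _ Mm); assumption.
Qed.

End Orthogonality.

(** * Normal monomorphisms *)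

Section NormalMono.
Context {C : category} (L : finitely_complete C) (K : finitely_cocomplete C).

(** Universal property of a pullback of a point along an arbitrary [x], independent of chosen
    limits. The triangle over the terminal object commutes by itself, so only [f ∘ t = b] is
    demanded. *)
Definition point_pullback (A B : C) (f : hom A B) : Prop :=
  exists (Z : C) (x : hom B Z) (z : hom (terminal L) Z),
    x ∘ f = z ∘ to_terminal L A /\
    forall (X : C) (b : hom X B), x ∘ b = z ∘ to_terminal L X ->
      exists! t : hom X A, f ∘ t = b.

Lemma point_comp (A B Z : C) (z : hom (terminal L) Z) (f : hom A B) :
  (z ∘ to_terminal L B) ∘ f = z ∘ to_terminal L A.
Proof. rewrite <- comp_assoc; f_equal; apply terminal_eq. Qed.

Lemma point_pullback_mono (A B : C) (f : hom A B) : point_pullback f -> mono f.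
Proof.
  intros (Z & x & z & e & U) X s t est.
  destruct (U X (f ∘ s)) as [r [_ ur]].
  - rewrite comp_assoc, e; apply point_comp.
  - rewrite <- (ur s), <- (ur t); auto.
Qed.

Lemma cokernel_in_nu (A B : C) (f : hom A B) :
  cokernel_in L K f ∘ nu L K f = cokernel_pt L K f ∘ to_terminal L (N_ L K f).
Proof.
  etransitivity; [apply pullback_comm|]; f_equal; apply terminal_eq.
Qed.

Lemma cokernel_factor (A B Z : C) (f : hom A B) (x : hom B Z) (z : hom (terminal L) Z) :
  x ∘ f = z ∘ to_terminal L A ->
  exists c, c ∘ cokernel_in L K f = x /\ c ∘ cokernel_pt L K f = z.
Proof.
  intros e; exists (pushout_copair K e); split;
    [apply pushout_copair_inl | apply pushout_copair_inr].
Qed.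

(** The pair [x], [z] factors through the pushout defining [nu], where [nu] is already constant at
    the point. Hence [nu] factors through every pullback of a point through which [f] factors. *)
Lemma nu_least (A B Z : C) (f : hom A B) (x : hom B Z) (z : hom (terminal L) Z) :
  x ∘ f = z ∘ to_terminal L A ->
  x ∘ nu L K f = z ∘ to_terminal L (N_ L K f).
Proof.
  intros e; destruct (cokernel_factor e) as [c [<- <-]].
  rewrite <- !comp_assoc, cokernel_in_nu; reflexivity.
Qed.

Lemma nu_point_pullback (A B : C) (f : hom A B) : point_pullback (nu L K f).
Proof.
  exists _, (cokernel_in L K f), (cokernel_pt L K f); split; [apply cokernel_in_nu|].
  intros X b e; exists (pullback_pair L e); split; [apply pullback_pair_fst|].
  intros t et; apply nu_mono; rewrite et; apply pullback_pair_fst.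
Qed.

Lemma point_pullback_id (A : C) : point_pullback (idm A).
Proof.
  exists _, (to_terminal L A), (idm (terminal L)); split; [apply terminal_eq|].
  intros X b _; exists b; split; [apply comp_idl|].
  intros t <-; apply comp_idl.
Qed.

Lemma point_pullback_iso_left (A B D : C) (f : hom A B) (i : hom B D) :
  point_pullback f -> is_iso i -> point_pullback (i ∘ f).
Proof.
  intros (Z & x & z & e & U) [j [ji ij]]; exists Z, (x ∘ j), z; split.
  - rewrite comp_assoc, <- (comp_assoc x), ji, comp_idr; exact e.
  - intros X b eb; rewrite <- comp_assoc in eb.
    destruct (U X _ eb) as [t [et ut]]; exists t; split.
    + rewrite <- comp_assoc, et, comp_assoc, ij, comp_idl; reflexivity.
    + intros t' <-; apply ut.
      rewrite !comp_assoc, ji, comp_idl; reflexivity.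
Qed.

Lemma point_pullback_iso_right (A B D : C) (i : hom A B) (f : hom B D) :
  is_iso i -> point_pullback f -> point_pullback (f ∘ i).
Proof.
  intros [j [ji ij]] (Z & x & z & e & U); exists Z, x, z; split.
  - rewrite comp_assoc, e; apply point_comp.
  - intros X b eb; destruct (U X _ eb) as [t [et ut]]; exists (j ∘ t); split.
    + rewrite <- comp_assoc, (comp_assoc i), ij, comp_idl; exact et.
    + intros t' et'; rewrite (ut (i ∘ t')), comp_assoc, ji, comp_idl; [reflexivity|].
      rewrite comp_assoc; exact et'.
Qed.

Lemma NMono_point_pullback (A B : C) (f : hom A B) :
  NMono L K f <-> point_pullback f.
Proof.
  split; intros H.
  - rewrite <- (nu_hat L K f).
    apply point_pullback_iso_right; [exact H | apply nu_point_pullback].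
  - pose proof (point_pullback_mono H) as m.
    destruct H as (Z & x & z & e & U).
    (* By minimality [nu] factors through [f]; the factor [t] is the inverse of [hat]. *)
    destruct (U _ _ (nu_least e)) as [t [et _]]; exists t; split.
    + apply m; rewrite comp_assoc, et, nu_hat, comp_idr; reflexivity.
    + apply (@nu_mono _ L K _ _ f); rewrite comp_assoc, nu_hat, comp_idr; exact et.
Qed.

Lemma NMono_id : contains_identities (NMono L K).
Proof. intros A; apply NMono_point_pullback, point_pullback_id. Qed.

Lemma NMono_iso : closed_under_iso (NMono L K).
Proof.
  split; intros A B D f g Hf Hg; apply NMono_point_pullback.
  - apply point_pullback_iso_left; [apply NMono_point_pullback, Hf | exact Hg].
  - apply point_pullback_iso_right; [exact Hf | apply NMono_point_pullback, Hg].
Qed.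

Lemma nu_NMono (A B : C) (f : hom A B) : NMono L K (nu L K f).
Proof. apply NMono_point_pullback, nu_point_pullback. Qed.

Lemma left_orth_NMono (A B : C) (f : hom A B) :
  left_orth (NMono L K) f <-> is_iso (nu L K f).
Proof.
  split.
  - intros o.
    (* The filler of the square expressing [nu ∘ hat = f] is a section of the monomorphism [nu]. *)
    destruct (o _ _ _ (nu_NMono f) (hat L K f) (idm B)) as [t [[_ et] _]].
    + rewrite comp_idl; apply nu_hat.
    + exact (mono_split_epi_iso (@nu_mono _ L K _ _ f) et).
  - intros [n [_ en]] X Y m Mm u v e; apply NMono_point_pullback in Mm.
    pose proof (point_pullback_mono Mm) as mm.
    destruct Mm as (Z & x & z & em & U).
    (* The equation holds after composition with [f], hence with [nu] by minimality, and [nu] is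
       cancelled by its section [n]. *)
    assert (ev : x ∘ v = z ∘ to_terminal L B).
    { assert (evf : (x ∘ v) ∘ f = z ∘ to_terminal L A).
      { rewrite <- comp_assoc, <- e, comp_assoc, em; apply point_comp. }
      rewrite <- (comp_idr (x ∘ v)), <- en, comp_assoc, (nu_least evf).
      apply point_comp. }
    destruct (U _ _ ev) as [t [et ut]]; exists t; repeat split.
    + apply mm; rewrite comp_assoc, et, e; reflexivity.
    + exact et.
    + intros t' [_ et']; apply ut, et'.
Qed.

(** Cancelling [f] in the pushout square makes [cokernel_in] itself constant at the point, so
    [idm B] factors through [nu]. *)
Lemma epi_left_orth_NMono (A B : C) (f : hom A B) :
  epi f -> left_orth (NMono L K) f.
Proof.
  intros ef; apply left_orth_NMono.
  assert (e : cokernel_in L K f ∘ idm B = cokernel_pt L K f ∘ to_terminal L B).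
  { rewrite comp_idr; apply ef; rewrite point_comp; apply pushout_comm. }
  exact (mono_split_epi_iso (@nu_mono _ L K _ _ f) (pullback_pair_fst L e)).
Qed.

Lemma hat_left_orth (A B : C) (f : hom A B) :
  left_orth (NMono L K) (kappa L K f) -> left_orth (NMono L K) (hat L K f).
Proof.
  intros o; rewrite <- kappa_pi; apply left_orth_comp; [|exact o].
  apply epi_left_orth_NMono; exact (@pi_epi _ L K _ _ f).
Qed.

Lemma NMono_comp_kappa :
  closed_under_comp (NMono L K) -> all_comparisons_in L K (left_orth (NMono L K)).
Proof.
  intros c A B f; apply left_orth_NMono.
  pose proof (c _ _ _ _ _ (nu_NMono (kappa L K f)) (nu_NMono f)) as n.
  apply NMono_point_pullback in n; destruct n as (Z & x & z & e & U).
  (* [f] factors through [nu f ∘ nu (kappa f)], which [x] makes constant at [z]. *)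
  assert (ef : x ∘ f = z ∘ to_terminal L A).
  { rewrite <- (nu_hat L K f), <- (kappa_pi L K f), <- (nu_hat L K (kappa L K f)).
    rewrite !comp_assoc; rewrite comp_assoc in e; rewrite e, !point_comp; reflexivity. }
  destruct (U _ _ (nu_least ef)) as [t [et _]].
  (* Cancelling [nu f] turns [t] into a section of [nu (kappa f)]. *)
  apply (@mono_split_epi_iso _ _ _ _ t (@nu_mono _ L K _ _ (kappa L K f))).
  apply (@nu_mono _ L K _ _ f); rewrite comp_assoc, et, comp_idr; reflexivity.
Qed.

Lemma kappa_NMono_ofs :
  all_comparisons_in L K (left_orth (NMono L K)) ->
  orthogonal_factorization_system (left_orth (NMono L K)) (NMono L K).
Proof.
  intros k; apply left_orth_ofs; [apply NMono_id | apply NMono_iso |].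
  intros A B f; exists _, (hat L K f), (nu L K f); repeat split.
  - apply hat_left_orth, k.
  - apply nu_NMono.
  - symmetry; apply nu_hat.
Qed.

End NormalMono.

(** * Normal epimorphisms *)

Section NormalEpi.
Context {C : category} (L : finitely_complete C) (K : finitely_cocomplete C).

(** Dual of [point_pullback]: [f] is a pushout of some morphism into the initial object. *)
Definition copoint_pushout (A B : C) (f : hom A B) : Prop :=
  exists (Z : C) (x : hom Z A) (z : hom Z (initial K)),
    f ∘ x = from_initial K B ∘ z /\
    forall (X : C) (a : hom A X), a ∘ x = from_initial K X ∘ z ->
      exists! t : hom B X, t ∘ f = a.

Lemma comp_copoint (A B Z : C) (z : hom Z (initial K)) (f : hom A B) :
  f ∘ (from_initial K A ∘ z) = from_initial K B ∘ z.
Proof. rewrite comp_assoc; f_equal; apply initial_eq. Qed.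

Lemma copoint_pushout_epi (A B : C) (f : hom A B) : copoint_pushout f -> epi f.
Proof.
  intros (Z & x & z & e & U) X s t est.
  destruct (U X (s ∘ f)) as [r [_ ur]].
  - rewrite <- comp_assoc, e; apply comp_copoint.
  - rewrite <- (ur s), <- (ur t); auto.
Qed.

Lemma pi_kernel_in (A B : C) (f : hom A B) :
  pi L K f ∘ kernel_in L K f = from_initial K (P_ L K f) ∘ kernel_zero L K f.
Proof.
  etransitivity; [symmetry; apply pushout_comm|]; f_equal; apply initial_eq.
Qed.

Lemma kernel_factor (A B Z : C) (f : hom A B) (x : hom Z A) (z : hom Z (initial K)) :
  f ∘ x = from_initial K B ∘ z ->
  exists c, kernel_in L K f ∘ c = x /\ kernel_zero L K f ∘ c = z.
Proof.
  intros e; exists (pullback_pair L (eq_sym e)); split;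
    [apply pullback_pair_snd | apply pullback_pair_fst].
Qed.

(** The pair [x], [z] factors through the pullback defining [pi]. Hence [pi] factors through every
    normal epimorphism through which [f] factors. *)
Lemma pi_greatest (A B Z : C) (f : hom A B) (x : hom Z A) (z : hom Z (initial K)) :
  f ∘ x = from_initial K B ∘ z ->
  pi L K f ∘ x = from_initial K (P_ L K f) ∘ z.
Proof.
  intros e; destruct (kernel_factor e) as [c [<- <-]].
  rewrite !comp_assoc, pi_kernel_in; reflexivity.
Qed.

Lemma pi_copoint_pushout (A B : C) (f : hom A B) : copoint_pushout (pi L K f).
Proof.
  exists _, (kernel_in L K f), (kernel_zero L K f); split; [apply pi_kernel_in|].
  intros X a e; exists (pushout_copair K (eq_sym e)); split; [apply pushout_copair_inr|].
  intros t et; apply pi_epi; rewrite et; apply pushout_copair_inr.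
Qed.

Lemma copoint_pushout_id (A : C) : copoint_pushout (idm A).
Proof.
  exists _, (from_initial K A), (idm (initial K)); split; [apply initial_eq|].
  intros X a _; exists a; split; [apply comp_idr|].
  intros t <-; apply comp_idr.
Qed.

Lemma copoint_pushout_iso_left (A B D : C) (f : hom A B) (i : hom B D) :
  copoint_pushout f -> is_iso i -> copoint_pushout (i ∘ f).
Proof.
  intros (Z & x & z & e & U) [j [ji ij]]; exists Z, x, z; split.
  - rewrite <- comp_assoc, e; apply comp_copoint.
  - intros X a ea; destruct (U X _ ea) as [t [et ut]]; exists (t ∘ j); split.
    + rewrite comp_assoc, <- (comp_assoc t), ji, comp_idr; exact et.
    + intros t' et'; rewrite (ut (t' ∘ i)), <- comp_assoc, ij, comp_idr; [reflexivity|].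
      rewrite <- comp_assoc; exact et'.
Qed.

Lemma copoint_pushout_iso_right (A B D : C) (i : hom A B) (f : hom B D) :
  is_iso i -> copoint_pushout f -> copoint_pushout (f ∘ i).
Proof.
  intros [j [ji ij]] (Z & x & z & e & U); exists Z, (j ∘ x), z; split.
  - rewrite <- comp_assoc, (comp_assoc i), ij, comp_idl; exact e.
  - intros X a ea; rewrite comp_assoc in ea.
    destruct (U X _ ea) as [t [et ut]]; exists t; split.
    + rewrite comp_assoc, et, <- comp_assoc, ji, comp_idr; reflexivity.
    + intros t' <-; apply ut.
      rewrite <- !comp_assoc, ij, comp_idr; reflexivity.
Qed.

Lemma NEpi_copoint_pushout (A B : C) (f : hom A B) :
  NEpi L K f <-> copoint_pushout f.
Proof.
  split; intros H.
  - rewrite <- (check_pi L K f).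
    apply copoint_pushout_iso_left; [apply pi_copoint_pushout | exact H].
  - pose proof (copoint_pushout_epi H) as m.
    destruct H as (Z & x & z & e & U).
    destruct (U _ _ (pi_greatest e)) as [t [et _]]; exists t; split.
    + apply (@pi_epi _ L K _ _ f); rewrite <- comp_assoc, check_pi, comp_idl; exact et.
    + apply m; rewrite <- comp_assoc, et, check_pi, comp_idl; reflexivity.
Qed.

Lemma NEpi_id : contains_identities (NEpi L K).
Proof. intros A; apply NEpi_copoint_pushout, copoint_pushout_id. Qed.

Lemma NEpi_iso : closed_under_iso (NEpi L K).
Proof.
  split; intros A B D f g Hf Hg; apply NEpi_copoint_pushout.
  - apply copoint_pushout_iso_left; [apply NEpi_copoint_pushout, Hf | exact Hg].
  - apply copoint_pushout_iso_right; [exact Hf | apply NEpi_copoint_pushout, Hg].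
Qed.

Lemma pi_NEpi (A B : C) (f : hom A B) : NEpi L K (pi L K f).
Proof. apply NEpi_copoint_pushout, pi_copoint_pushout. Qed.

Lemma right_orth_NEpi (A B : C) (f : hom A B) :
  right_orth (NEpi L K) f <-> is_iso (pi L K f).
Proof.
  split.
  - intros o.
    destruct (o _ _ _ (pi_NEpi f) (idm A) (check L K f)) as [t [[et _] _]].
    + rewrite comp_idr; symmetry; apply check_pi.
    + exact (epi_split_mono_iso (@pi_epi _ L K _ _ f) et).
  - intros [n [en _]] X Y p Pp u v e; apply NEpi_copoint_pushout in Pp.
    pose proof (copoint_pushout_epi Pp) as pp.
    destruct Pp as (Z & x & z & ep & U).
    (* The equation holds after composition with [f], hence with [pi], which is cancelled by its
       retraction [n]. *)
    assert (eu : u ∘ x = from_initial K A ∘ z).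
    { assert (efu : f ∘ (u ∘ x) = from_initial K B ∘ z).
      { rewrite comp_assoc, e, <- comp_assoc, ep; apply comp_copoint. }
      rewrite <- (comp_idl (u ∘ x)), <- en, <- comp_assoc, (pi_greatest efu).
      apply comp_copoint. }
    destruct (U _ _ eu) as [t [et ut]]; exists t; repeat split.
    + exact et.
    + apply pp; rewrite <- comp_assoc, et, e; reflexivity.
    + intros t' [et' _]; apply ut, et'.
Qed.

(** Cancelling [f] in the pullback square makes [kernel_in] factor through the initial object, so
    [idm A] factors through [pi]. *)
Lemma mono_right_orth_NEpi (A B : C) (f : hom A B) :
  mono f -> right_orth (NEpi L K) f.
Proof.
  intros mf; apply right_orth_NEpi.
  assert (e : from_initial K A ∘ kernel_zero L K f = idm A ∘ kernel_in L K f).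
  { rewrite comp_idl; apply mf; rewrite comp_copoint; apply pullback_comm. }
  exact (epi_split_mono_iso (@pi_epi _ L K _ _ f) (pushout_copair_inr K e)).
Qed.

Lemma check_right_orth (A B : C) (f : hom A B) :
  right_orth (NEpi L K) (kappa L K f) -> right_orth (NEpi L K) (check L K f).
Proof.
  intros o; rewrite <- nu_kappa; apply right_orth_comp; [exact o|].
  apply mono_right_orth_NEpi; exact (@nu_mono _ L K _ _ f).
Qed.

Lemma NEpi_comp_kappa :
  closed_under_comp (NEpi L K) -> all_comparisons_in L K (right_orth (NEpi L K)).
Proof.
  intros c A B f; apply right_orth_NEpi.
  pose proof (c _ _ _ _ _ (pi_NEpi f) (pi_NEpi (kappa L K f))) as n.
  apply NEpi_copoint_pushout in n; destruct n as (Z & x & z & e & U).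
  (* [f] factors through [pi (kappa f) ∘ pi f], which sends [x] through the initial object. *)
  assert (ef : f ∘ x = from_initial K B ∘ z).
  { rewrite <- (check_pi L K f), <- (nu_kappa L K f), <- (check_pi L K (kappa L K f)).
    rewrite <- !comp_assoc; rewrite <- comp_assoc in e.
    rewrite e, !comp_copoint; reflexivity. }
  destruct (U _ _ (pi_greatest ef)) as [t [et _]].
  apply (@epi_split_mono_iso _ _ _ _ t (@pi_epi _ L K _ _ (kappa L K f))).
  apply (@pi_epi _ L K _ _ f); rewrite <- comp_assoc, et, comp_idl; reflexivity.
Qed.

Lemma kappa_NEpi_ofs :
  all_comparisons_in L K (right_orth (NEpi L K)) ->
  orthogonal_factorization_system (NEpi L K) (right_orth (NEpi L K)).
Proof.
  intros k; apply right_orth_ofs; [apply NEpi_id | apply NEpi_iso |].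
  intros A B f; exists _, (pi L K f), (check L K f); repeat split.
  - apply pi_NEpi.
  - apply check_right_orth, k.
  - symmetry; apply check_pi.
Qed.

End NormalEpi.

(** * Perfect normal decompositions *)

Lemma class_meet_orth_KClass (C : category) (L : finitely_complete C)
    (K : finitely_cocomplete C) (A B : C) (f : hom A B) :
  class_meet (left_orth (NMono L K)) (right_orth (NEpi L K)) f <-> KClass L K f.
Proof. unfold class_meet, KClass; rewrite left_orth_NMono, right_orth_NEpi; reflexivity. Qed.

Theorem theorem4p2 (C : category) (L : finitely_complete C) (K : finitely_cocomplete C) :
  (* (1) *)
  ((closed_under_comp (NMono L K) <->
      exists E : mor_class C, orthogonal_factorization_system E (NMono L K)) /\
   (closed_under_comp (NMono L K) <->
      all_comparisons_in L K (left_orth (NMono L K)))) /\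
  (* (2) *)
  ((closed_under_comp (NEpi L K) <->
      exists F : mor_class C, orthogonal_factorization_system (NEpi L K) F) /\
   (closed_under_comp (NEpi L K) <->
      all_comparisons_in L K (right_orth (NEpi L K)))) /\
  (* (3) *)
  ((all_comparisons_in L K
      (class_meet (left_orth (NMono L K)) (right_orth (NEpi L K))) <->
    closed_under_comp (NMono L K) /\ closed_under_comp (NEpi L K)) /\
   (all_comparisons_in L K
      (class_meet (left_orth (NMono L K)) (right_orth (NEpi L K))) <->
    all_comparisons_in L K (KClass L K))).
Proof.
  (* In (1) and (2), condition (iii) gives (i) by way of the factorization system of (ii). *)
  assert (n : all_comparisons_in L K (left_orth (NMono L K)) ->
              closed_under_comp (NMono L K)).
  { intros k; exact (ofs_right_comp (kappa_NMono_ofs k)). }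
  assert (p : all_comparisons_in L K (right_orth (NEpi L K)) ->
              closed_under_comp (NEpi L K)).
  { intros k; exact (ofs_left_comp (kappa_NEpi_ofs k)). }
  split; [|split]; (split; split).
  (* The witness for the left class is [left_orth (NMono L K)], reached through (iii). *)
  - intros c; eexists; apply kappa_NMono_ofs, NMono_comp_kappa, c.
  - intros [E F]; exact (ofs_right_comp F).
  - apply NMono_comp_kappa.
  - exact n.
  - intros c; eexists; apply kappa_NEpi_ofs, NEpi_comp_kappa, c.
  - intros [F H]; exact (ofs_left_comp H).
  - apply NEpi_comp_kappa.
  - exact p.
  - intros k; split; [apply n | apply p]; intros A B f; apply k.
  - intros [cn cp] A B f; split; [apply NMono_comp_kappa, cn | apply NEpi_comp_kappa, cp].
  - intros k A B f; apply class_meet_orth_KClass, k.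
  - intros k A B f; apply class_meet_orth_KClass, k.
Qed.
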